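(* Let $d\ge 1$ and let $n_1,\dots,n_d$ and $p_1,\dots,p_d$ be positive integers with $p_l^2 \mid n_l$ for all $l=1,\dots,d$. Let $X$ be a $d$-dimensional array of complex numbers of size $n_1\times\cdots\times n_d$, distributed over $p_1\times\cdots\times p_d$ processors by the $d$-dimensional cyclic distribution. Let $V$ be the global $n_1\times\cdots\times n_d$ array whose local parts $V^{(s)}$, $s\in[p_1]\times\cdots\times[p_d]$, in the $d$-dimensional cyclic distribution are the outputs of the parallel four-step algorithm (described in the context) applied to $X$. Then $V$ is the $d$-dimensional discrete Fourier transform of $X$, i.e. $V=(F_{n_1}\otimes\cdots\otimes F_{n_d})(X)$: for all $(k_1,\dots,k_d)\in[n_1]\times\cdots\times[n_d]$, $$V[k_1,\dots,k_d]=\sum_{j_1\in[n_1]}\cdots\sum_{j_d\in[n_d]}X[j_1,\dots,j_d]\,\omega_{n_1}^{j_1k_1}\cdots\omega_{n_d}^{j_dk_d}.$$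
   Context: Notation. For a positive integer $m$, $[m]=\{0,\dots,m-1\}$ and $\omega_m=e^{-2\pi i/m}$. All array indices start at $0$. For positive integers $m_1,\dots,m_d$, $F_{m_1}\otimes\cdots\otimes F_{m_d}$ denotes the $d$-dimensional discrete Fourier transform on complex arrays of size $m_1\times\cdots\times m_d$, which sends $A$ to the array $B$ with $B[k]=\sum_{j_1\in[m_1]}\cdots\sum_{j_d\in[m_d]}A[j_1,\dots,j_d]\,\omega_{m_1}^{j_1k_1}\cdots\omega_{m_d}^{j_dk_d}$ for $k\in[m_1]\times\cdots\times[m_d]$. Operations on $d$-tuples are componentwise: with $n=(n_1,\dots,n_d)$ and $p=(p_1,\dots,p_d)$, for example $s+kp=(s_1+k_1p_1,\dots,s_d+k_dp_d)$, $\frac{n}{p}=(n_1/p_1,\dots,n_d/p_d)$ and $\frac{n}{p^2}=(n_1/p_1^2,\dots,n_d/p_d^2)$. Strided subarrays: for an array $A$ of size $c_1\times\cdots\times c_d$ and tuples $a,b$ with $b_l\mid c_l$ and $a_l\in[b_l]$, $A(a:b:c)$ is the array of size $(c_1/b_1)\times\cdots\times(c_d/b_d)$ with entries $A(a:b:c)[i]=A[a+ib]$. Contiguous subarrays: $A[a:b]$ (both ends inclusive, in each dimension) is the array with entries $A[a:b][i]=A[a+i]$, $0\le i_l\le b_l-a_l$. Cyclic distribution: the processors are $P(s)$ for $s=(s_1,\dots,s_d)\in[p_1]\times\cdots\times[p_d]$. A global array $A$ of size $n_1\times\cdots\times n_d$ is stored so that $P(s)$ holds the local array $A^{(s)}$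 of size $(n_1/p_1)\times\cdots\times(n_d/p_d)$ given by $A^{(s)}[k]=A[s+kp]$, for $k\in[n_1/p_1]\times\cdots\times[n_d/p_d]$. Parallel four-step algorithm in $d$ dimensions. Every processor $P(s)$ performs the following supersteps (all processors complete one superstep before the data communicated in it is used in the next). All local arrays $X^{(s)},Y^{(s)},Z^{(s)},W^{(s)},V^{(s)}$ have size $(n_1/p_1)\times\cdots\times(n_d/p_d)$. Superstep 0: set $Y^{(s)}:=(F_{n_1/p_1}\otimes\cdots\otimes F_{n_d/p_d})(X^{(s)})$; then for every $k\in[n_1/p_1]\times\cdots\times[n_d/p_d]$ set $Z^{(s)}[k]:=\bigl(\prod_{l=1}^d\omega_{n_l}^{k_ls_l}\bigr)Y^{(s)}[k]$. Superstep 1 (communication): for every $k\in[p_1]\times\cdots\times[p_d]$, put $Z^{(s)}(k:p:\frac{n}{p})$ in $P(k)$ as $W^{(k)}\bigl[s\frac{n}{p^2}:(s+1)\frac{n}{p^2}-1\bigr]$ (where $(s+1)\frac{n}{p^2}-1$ has components $(s_l+1)n_l/p_l^2-1$); that is, $W^{(k)}\bigl[s\frac{n}{p^2}+t\bigr]:=Z^{(s)}[k+tp]$ for all $t\in[n_1/p_1^2]\times\cdots\times[n_d/p_d^2]$. Superstep 2: for every $t\in[n_1/p_1^2]\times\cdots\times[n_d/p_d^2]$, set $V^{(s)}(t:\frac{n}{p^2}:\frac{n}{p}):=(F_{p_1}\otimes\cdots\otimes F_{p_d})\bigl(W^{(s)}(t:\frac{n}{p^2}:\frac{n}{p})\bigr)$.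 *)

(* Defs.v *)
From HB Require Import structures.
From mathcomp Require Import all_boot all_order all_algebra.
From mathcomp Require Import complex reals sequences exp trigo.

Set Implicit Arguments.
Unset Strict Implicit.
Unset Printing Implicit Defensive.

Import Order.TTheory GRing.Theory Num.Theory.
Local Open Scope ring_scope.
Local Open Scope complex_scope.

Definition cexp (R : realType) (z : R[i]) : R[i] :=
  let: x +i* y := z in (expR x)%:C * (cos y +i* sin y).

Definition omega (R : realType) (m : nat) : R[i] :=
  cexp (0 +i* (- 2 * pi / m%:R)).

(* Index tuples k = (k_l)_l with 0 <= k_l < m_l; the size m = (m_l)_l is a
   function of the dimension l. *)
Definition idx (d : nat) (m : 'I_d -> nat) : finType :=
  {dffun forall l : 'I_d, 'I_(m l)}.

Definition array (R : realType) (d : nat) (m : 'I_d -> nat) : Type :=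
  {ffun idx m -> R[i]}.

(* F_{m_1} (x) ... (x) F_{m_d}; the nested sums over the j_l are one sum over
   the tuple j. *)
Definition dft (R : realType) (d : nat) (m : 'I_d -> nat) (A : array R m) :
    array R m :=
  [ffun k : idx m =>
    \sum_(j : idx m) A j * \prod_(l < d) omega R (m l) ^+ (j l * k l)].

(* In the next definitions the hypothesis b_l * q_l = c_l expresses b_l %| c_l
   together with q_l = c_l / b_l, so that no cast is needed between sizes such
   as (n/p)/p and n/p^2. *)

Lemma ltn_stride (b q c a i : nat) :
  (b * q = c -> a < b -> i < q -> a + i * b < c)%N.
Proof.
move=> <- ab iq; apply: (@leq_trans (b + i * b)); first by rewrite ltn_add2r.
by rewrite -mulSn mulnC leq_pmul2l // (leq_ltn_trans _ ab).
Qed.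

(* The index a + i b. *)
Definition stride_idx (d : nat) (b q c : 'I_d -> nat)
    (bqc : forall l, (b l * q l)%N = c l) (a : idx b) (i : idx q) : idx c :=
  finfun (fun l : 'I_d =>
    Ordinal (ltn_stride (bqc l) (ltn_ord (a l)) (ltn_ord (i l)))).

(* The strided subarray A(a : b : c), of size q = c / b. *)
Definition strided (R : realType) (d : nat) (b q c : 'I_d -> nat)
    (bqc : forall l, (b l * q l)%N = c l) (A : array R c) (a : idx b) :
    array R q :=
  [ffun i : idx q => A (stride_idx bqc a i)].

(* The contiguous subarray A[s m : (s + 1) m - 1], of size m, in an array A of
   size c = m q; its entry t is A[s m + t], and s m + t is the index
   stride_idx t s. *)
Definition block (R : realType) (d : nat) (m q c : 'I_d -> nat)
    (mqc : forall l, (m l * q l)%N = c l) (A : array R c) (s : idx q) :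
    array R m :=
  [ffun t : idx m => A (stride_idx mqc t s)].

Section Sizes.
Context (d : nat) (n p : 'I_d -> nat).

Definition nbyp (l : 'I_d) : nat := (n l %/ p l)%N.
Definition nbyp2 (l : 'I_d) : nat := (n l %/ p l ^ 2)%N.

Context (p2n : forall l, (p l ^ 2 %| n l)%N).

Lemma p_nbyp (l : 'I_d) : (p l * nbyp l)%N = n l.
Proof. by rewrite mulnC divnK // (dvdn_trans _ (p2n l)) // dvdn_exp. Qed.

Lemma p_nbyp2 (l : 'I_d) : (p l * nbyp2 l)%N = nbyp l.
Proof.
have [p0|p_gt0] := posnP (p l); first by rewrite /nbyp p0 mul0n divn0.
apply/eqP; rewrite -(eqn_pmul2l p_gt0) p_nbyp mulnA mulnn mulnC.
by rewrite divnK.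
Qed.

Lemma nbyp2_p (l : 'I_d) : (nbyp2 l * p l)%N = nbyp l.
Proof. by rewrite mulnC p_nbyp2. Qed.

End Sizes.

(* The local parts of A in the cyclic distribution: A^(s)[k] = A[s + k p]. *)
Definition cyclic (R : realType) (d : nat) (n p : 'I_d -> nat)
    (p2n : forall l, (p l ^ 2 %| n l)%N) (A : array R n) (s : idx p) :
    array R (nbyp n p) :=
  strided (p_nbyp p2n) A s.

(* "On local input X, the parallel four-step algorithm outputs V."  Each entry
   of Y, Z, W, V is assigned exactly once, so that the assignments are read as
   equations; four_step_total below shows that they can always be satisfied.
   The first two are the local computation, the third is the communication
   (every P(s) puts a strided part of Z^(s) in every P(k)) and the last one the
   final local computation. *)
Definition four_step (R : realType) (d : nat) (n p : 'I_d -> nat)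
    (p2n : forall l, (p l ^ 2 %| n l)%N)
    (X V : idx p -> array R (nbyp n p)) : Prop :=
  exists Y Z W : idx p -> array R (nbyp n p),
  [/\ forall s : idx p, Y s = dft (X s),
      forall (s : idx p) (k : idx (nbyp n p)),
        Z s k = (\prod_(l < d) omega R (n l) ^+ (k l * s l)) * Y s k,
      forall s k : idx p,
        block (nbyp2_p p2n) (W k) s = strided (p_nbyp2 p2n) (Z s) k &
      forall (s : idx p) (t : idx (nbyp2 n p)),
        strided (nbyp2_p p2n) (V s) t =
        dft (strided (nbyp2_p p2n) (W s) t)].

Lemma stride_idx_bij (d : nat) (b q c : 'I_d -> nat)
    (bqc : forall l, (b l * q l)%N = c l) :
  exists lo : idx c -> idx b, exists hi : idx c -> idx q,
    forall a i, lo (stride_idx bqc a i) = a /\ hi (stride_idx bqc a i) = i.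
Proof.
have b_gt0 l (x : 'I_(c l)) : (0 < b l)%N.
  by rewrite lt0n; apply/eqP => b0; case: x; rewrite -bqc b0.
have lo_lt l (x : 'I_(c l)) : (x %% b l < b l)%N by rewrite ltn_mod (b_gt0 _ x).
have hi_lt l (x : 'I_(c l)) : (x %/ b l < q l)%N.
  by rewrite ltn_divLR ?(b_gt0 _ x) // mulnC bqc.
exists (fun x : idx c => finfun (fun l => Ordinal (lo_lt l (x l)))).
exists (fun x : idx c => finfun (fun l => Ordinal (hi_lt l (x l)))).
move=> a i; split; apply/ffunP => l; apply: val_inj; rewrite !ffunE /=.
- by rewrite addnC modnMDl modn_small.
- rewrite addnC divnMDl ?divn_small ?addn0 //.
  exact: leq_ltn_trans (ltn_ord (a l)).
Qed.

Lemma strided_surj (R : realType) (d : nat) (b q c : 'I_d -> nat)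
    (bqc : forall l, (b l * q l)%N = c l) (B : idx b -> array R q) :
  exists A : array R c, forall a, strided bqc A a = B a.
Proof.
have [lo [hi lohi]] := stride_idx_bij bqc.
exists [ffun x : idx c => B (lo x) (hi x)] => a; apply/ffunP => i.
by rewrite !ffunE; have [-> ->] := lohi a i.
Qed.

Lemma block_surj (R : realType) (d : nat) (m q c : 'I_d -> nat)
    (mqc : forall l, (m l * q l)%N = c l) (B : idx q -> array R m) :
  exists A : array R c, forall s, block mqc A s = B s.
Proof.
have [lo [hi lohi]] := stride_idx_bij mqc.
exists [ffun x : idx c => B (hi x) (lo x)] => s; apply/ffunP => t.
by rewrite !ffunE; have [-> ->] := lohi t s.
Qed.

Lemma four_step_total (R : realType) (d : nat) (n p : 'I_d -> nat)
    (p2n : forall l, (p l ^ 2 %| n l)%N) (X : array R n) :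
  exists V : array R n, four_step p2n (cyclic p2n X) (cyclic p2n V).
Proof.
pose Y (s : idx p) := dft (cyclic p2n X s).
pose Z (s : idx p) : array R (nbyp n p) := [ffun k : idx (nbyp n p) =>
  (\prod_(l < d) omega R (n l) ^+ (k l * s l)) * Y s k].
have [W WE] := fin_all_exists (fun k : idx p => block_surj (nbyp2_p p2n)
  (fun s => strided (p_nbyp2 p2n) (Z s) k)).
have [V' V'E] := fin_all_exists (fun s : idx p => strided_surj (nbyp2_p p2n)
  (fun t => dft (strided (nbyp2_p p2n) (W s) t))).
have [V VE] := strided_surj (p_nbyp p2n) V'.
exists V, Y, Z, W; split=> // [s k|s t]; first by rewrite ffunE.
by rewrite /cyclic VE.
Qed.

(* Main.v *)
(* Write every index of the input as j + r p and every index of the output as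
   s + (t + i n/p^2) p.  The exponent of omega_n then splits as
     (j + r p) (s + (t + i n/p^2) p)
       = j (s + t p) + p r (s + t p) + (n/p) j i + n r i,
   and since omega_(a b)^a = omega_b and omega_n^n = 1, the four terms are the
   twiddle factor, the local transform of size n/p, the final transform of size
   p, and 1. *)
Require Import Defs.
From HB Require Import structures.
From mathcomp Require Import all_boot all_order all_algebra.
From mathcomp Require Import complex reals sequences exp trigo.
From mathcomp Require Import ring.

Set Implicit Arguments.
Unset Strict Implicit.
Unset Printing Implicit Defensive.

Import GRing.Theory Num.Theory.
Local Open Scope ring_scope.
Local Open Scope complex_scope.

Lemma cexpD (R : realType) (z w : R[i]) :
  cexp (z + w) = cexp z * cexp w.
Proof.
case: z w => [a b] [c e]; rewrite /cexp /= expRD cosD sinD.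
by apply/eqP; rewrite eq_complex /=; apply/andP; split; apply/eqP; ring.
Qed.

Lemma cexp_pure_expr (R : realType) (y : R) (k : nat) :
  cexp (0 +i* y) ^+ k = cexp (0 +i* (k%:R * y)).
Proof.
elim: k => [|k IHk]; first by rewrite expr0 mul0r /cexp expR0 cos0 sin0 mul1r.
rewrite exprS IHk -cexpD; congr cexp.
by apply/eqP; rewrite eq_complex /=; apply/andP; split; apply/eqP; ring.
Qed.

Lemma omega_expr (R : realType) (m : nat) : omega R m ^+ m = 1.
Proof.
(* For [m = 0] the angle is a division by zero, but the exponent is then 0 as well. *)
have [->|m_gt0] := posnP m; first by rewrite expr0.
rewrite /omega cexp_pure_expr mulrC divfK ?pnatr_eq0 -?lt0n //.
rewrite /cexp expR0 mul1r mulNr mulr_natl cosN sinN.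
by rewrite cos2pi sin2pi oppr0.
Qed.

Lemma omega_mul_expr (R : realType) (a b : nat) :
  (0 < a)%N -> omega R (a * b) ^+ a = omega R b.
Proof.
(* [invfM] covers [b = 0] too: there x / 0 = 0 makes both sides 1. *)
move=> a_gt0; rewrite /omega cexp_pure_expr natrM invfM mulrCA mulVKf //.
by rewrite pnatr_eq0 -lt0n.
Qed.

(** The exponent splitting in one dimension, with [N], [q], [m] standing for n, n/p, n/p^2. *)
Lemma omega_four_step (R : realType) (N p q m j r s t i : nat) :
  (0 < N)%N -> (p * q)%N = N -> (m * p)%N = q ->
  omega R N ^+ ((j + r * p) * (s + (t + i * m) * p)) =
  omega R q ^+ (r * (s + t * p)) * omega R N ^+ ((s + t * p) * j) *
  omega R p ^+ (j * i).
Proof.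
move=> N_gt0 pqN mpq.
have /andP[p_gt0 q_gt0] : (0 < p)%N && (0 < q)%N by rewrite -muln_gt0 pqN.
have -> : ((j + r * p) * (s + (t + i * m) * p) =
  p * (r * (s + t * p)) + (s + t * p) * j + q * (j * i) + N * (r * i))%N.
  by rewrite -pqN -mpq; ring.
rewrite 3!exprD !(exprM _ p) !(exprM _ q) (exprM _ N) omega_expr expr1n mulr1.
have -> : omega R N ^+ p = omega R q by rewrite -pqN omega_mul_expr.
by have -> : omega R N ^+ q = omega R p by rewrite -pqN mulnC omega_mul_expr.
Qed.

Section StrideIndex.
Context (d : nat) (b q c : 'I_d -> nat).
Context (bqc : forall l, (b l * q l)%N = c l).

Lemma stride_idx_surj (x : idx c) : exists a i, x = stride_idx bqc a i.
Proof.
(* The coordinate [x l] lies below [c l], so the product [b l * q l] is positive. *)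
have b_gt0 l : (0 < b l)%N.
  have := leq_ltn_trans (leq0n _) (ltn_ord (x l)).
  by rewrite -{1}bqc muln_gt0 => /andP[].
have lo_lt l : (x l %% b l < b l)%N by rewrite ltn_mod.
have hi_lt l : (x l %/ b l < q l)%N by rewrite ltn_divLR // mulnC bqc.
exists (finfun (fun l => Ordinal (lo_lt l))).
exists (finfun (fun l => Ordinal (hi_lt l))).
apply/ffunP => l; apply: val_inj; rewrite !ffunE /=.
by rewrite addnC -divn_eq.
Qed.

(** The left inverse from [stride_idx_bij] is two-sided by [stride_idx_surj], so the sum can be
    reindexed. *)
Lemma sum_stride_idx (V : nmodType) (F : idx c -> V) :
  \sum_x F x = \sum_a \sum_i F (stride_idx bqc a i).
Proof.
have [lo [hi lohi]] := stride_idx_bij bqc.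
rewrite pair_bigA /= (reindex (fun u => stride_idx bqc u.1 u.2)) //.
apply: onW_bij; exists (fun x => (lo x, hi x)) => [[a i]|x] /=.
  by have [-> ->] := lohi a i.
by have [a [i ->]] := stride_idx_surj x; have [-> ->] := lohi a i.
Qed.

End StrideIndex.

(** The supersteps are unwound backwards from [V]: the final transform yields the sum over the
    source processor [j], the local transform in [P(j)] the sum over [r]. *)
Lemma four_stepE (R : realType) (d : nat) (n p : 'I_d -> nat)
    (p2n : forall l : 'I_d, (p l ^ 2 %| n l)%N)
    (X V : idx p -> array R (nbyp n p)) (s i : idx p) (t : idx (nbyp2 n p)) :
  four_step p2n X V ->
  V s (stride_idx (nbyp2_p p2n) t i) =
  \sum_(j : idx p) \sum_(r : idx (nbyp n p)) X j r * \prod_(l < d)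
    (omega R (nbyp n p l) ^+ (r l * (s l + t l * p l)) *
     omega R (n l) ^+ ((s l + t l * p l) * j l) *
     omega R (p l) ^+ (j l * i l)).
Proof.
case=> [Y [Z [W [YE ZE WE VE]]]].
have /ffunP/(_ i) := VE s t; rewrite !ffunE => ->.
apply: eq_bigr => j _; rewrite ffunE.
(* Entry [j] of the strided part of [W s] at [t] is also entry [t] of block [j], hence it is the
   value of [Z j] at s + t p. *)
have /ffunP/(_ t) := WE j s; rewrite !ffunE => ->.
rewrite ZE YE ffunE mulr_sumr mulr_suml; apply: eq_bigr => r _.
rewrite !big_split /=.
under [in X in (X * _ * _)]eq_bigr => l _ do rewrite ffunE /=.
under [in X in (_ * (_ * X) * _)]eq_bigr => l _ do rewrite ffunE /=.
by rewrite !mulrA; congr (_ * _); rewrite -mulrA mulrC.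
Qed.

Theorem theorem1 (R : realType) (d : nat) (n p : 'I_d -> nat)
    (d_gt0 : (0 < d)%N)
    (n_gt0 : forall l : 'I_d, (0 < n l)%N)
    (p_gt0 : forall l : 'I_d, (0 < p l)%N)
    (p2n : forall l : 'I_d, (p l ^ 2 %| n l)%N)
    (X V : array R n)
    (run : four_step p2n (cyclic p2n X) (cyclic p2n V)) :
  V = dft X.
Proof.
apply/ffunP => k.
have [s [u ->]] := stride_idx_surj (p_nbyp p2n) k.
have [t [i ->]] := stride_idx_surj (nbyp2_p p2n) u.
have := four_stepE s i t run; rewrite ffunE => ->.
(* Grouping the inputs by owning processor gives the double sum of [four_stepE], so the summands can
   be compared one by one. *)
rewrite ffunE (sum_stride_idx (p_nbyp p2n)).
apply: eq_bigr => j _; apply: eq_bigr => r _; rewrite ffunE.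
congr (_ * _); apply: eq_bigr => l _; rewrite !ffunE /=.
by rewrite (omega_four_step _ _ _ _ _ _ (n_gt0 l)
  (p_nbyp p2n l) (nbyp2_p p2n l)).
Qed.
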